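(* Let $d\ge0$ be an integer, let $\mathcal{T}$ be a triangulated category with shift $\Sigma$, and let $\mathcal{M}\subseteq\mathcal{T}$ be a $(d+2)$-cluster-tilting subcategory. Then the extriangulated category $\mathcal{T}_{\mathcal{M}}$ is $d$-Auslander.
   Context: Extriangulated categories are in the sense of Nakaoka–Palu; $X\rightarrowtail Y\twoheadrightarrow Z$ denotes a conflation. For $n\ge1$, a full subcategory $\mathcal{M}$ of $\mathcal{T}$ is $n$-cluster-tilting if it is functorially finite and $\mathcal{M}=\{X\in\mathcal{T}\mid \mathrm{Hom}_{\mathcal{T}}(X,\Sigma^iM)=0 \text{ for all } M\in\mathcal{M},\ 1\le i<n\}=\{X\in\mathcal{T}\mid \mathrm{Hom}_{\mathcal{T}}(M,\Sigma^iX)=0 \text{ for all } M\in\mathcal{M},\ 1\le i<n\}$. $\mathcal{T}_{\mathcal{M}}$ is the additive category $\mathcal{T}$ with the relative extriangulated structure whose extension bifunctor is $\mathbb{E}_{\mathcal{M}}(C,A)=\{\delta\in\mathrm{Hom}_{\mathcal{T}}(C,\Sigma A)\mid \delta\circ f=0\text{ for all } M\in\mathcal{M},\ f\in\mathrm{Hom}_{\mathcal{T}}(M,C)\}$, with $\delta$ realized by $A\to B\to C$ where $A\to B\to C\xrightarrow{\delta}\Sigma A$ is a triangle. (It is known that this is an extriangulated category.) An extriangulated category $\mathcal{C}$ is $d$-Auslander if: (i) it has enough projectives; (ii) its global dimension is at most $d+1$: for every $X\in\mathcal{C}$ there are conflations $X_i\rightarrowtail P_i\twoheadrightarrow X_{i-1}$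 for $1\le i\le d+1$ with $X_0=X$, all $P_i$ projective and $X_{d+1}$ projective; (iii) its dominant dimension is at least $d+1$: for every projective $P$ there are conflations $X_i\rightarrowtail Q_i\twoheadrightarrow X_{i+1}$ for $1\le i\le d+1$ with $X_1=P$, all $Q_i$ projective-injective and $X_{d+2}$ injective. *)

(* Defs.v *)
From HB Require Import structures.
From mathcomp Require Import all_boot all_algebra.
From mathcomp Require Import boolp.
Set Implicit Arguments.
Unset Strict Implicit.
Unset Printing Implicit Defensive.
Import GRing.Theory.
Local Open Scope ring_scope.

Declare Scope cat_scope.
Delimit Scope cat_scope with cat.

Record biproduct_spec (obj : Type) (mor : obj -> obj -> zmodType)
    (idt : forall A, mor A A)
    (mcomp : forall A B C, mor B C -> mor A B -> mor A C)
    (A B S : obj) (i1 : mor A S) (i2 : mor B S) (p1 : mor S A) (p2 : mor S B)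
    : Prop := BiproductSpec {
  bp11 : mcomp _ _ _ p1 i1 = idt A;
  bp22 : mcomp _ _ _ p2 i2 = idt B;
  bp12 : mcomp _ _ _ p1 i2 = 0;
  bp21 : mcomp _ _ _ p2 i1 = 0;
  bp_sum : mcomp _ _ _ i1 p1 + mcomp _ _ _ i2 p2 = idt S
}.

Record additive_category := AdditiveCategory {
  obj :> Type;
  mor : obj -> obj -> zmodType;
  idt : forall A, mor A A;
  mcomp : forall A B C, mor B C -> mor A B -> mor A C;
  mcompA : forall A B C D (h : mor C D) (g : mor B C) (f : mor A B),
    mcomp h (mcomp g f) = mcomp (mcomp h g) f;
  mcomp1m : forall A B (f : mor A B), mcomp (idt B) f = f;
  mcompm1 : forall A B (f : mor A B), mcomp f (idt A) = f;
  mcompDl : forall A B C (g g' : mor B C) (f : mor A B),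
    mcomp (g + g') f = mcomp g f + mcomp g' f;
  mcompDr : forall A B C (g : mor B C) (f f' : mor A B),
    mcomp g (f + f') = mcomp g f + mcomp g f';
  has_zero : exists Z : obj,
    forall A, (forall f : mor A Z, f = 0) /\ (forall f : mor Z A, f = 0);
  has_biproducts : forall A B : obj,
    exists S (i1 : mor A S) (i2 : mor B S) (p1 : mor S A) (p2 : mor S B),
      biproduct_spec idt mcomp i1 i2 p1 p2
}.

Arguments mor {a} A B.
Arguments idt {a} A.
Arguments mcomp {a A B C} g f.

Notation "g ∘ f" := (mcomp g f) (at level 40, left associativity) : cat_scope.
Local Open Scope cat_scope.

Notation is_biproduct i1 i2 p1 p2 := (biproduct_spec idt (@mcomp _) i1 i2 p1 p2).

Definition is_iso (C : additive_category) (A B : C) (f : mor A B) : Prop :=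
  exists g : mor B A, g ∘ f = idt A /\ f ∘ g = idt B.

(* The shift is an additive autoequivalence (fully faithful and essentially
   surjective), not necessarily a strict automorphism. *)
Record triangulated_category := TriangulatedCategory {
  tcat :> additive_category;
  shift : tcat -> tcat;
  shiftm : forall A B : tcat, mor A B -> mor (shift A) (shift B);
  shiftm1 : forall A : tcat, shiftm (idt A) = idt (shift A);
  shiftmM : forall (A B C : tcat) (g : mor B C) (f : mor A B),
    shiftm (g ∘ f) = shiftm g ∘ shiftm f;
  shiftmD : forall (A B : tcat) (f g : mor A B),
    shiftm (f + g) = shiftm f + shiftm g;
  shiftm_bij : forall A B : tcat, bijective (@shiftm A B);
  shift_esurj : forall B : tcat, exists A (f : mor (shift A) B), is_iso f;
  dist : forall A B C : tcat,
    mor A B -> mor B C -> mor C (shift A) -> Prop;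
  dist_iso : forall (A B C A' B' C' : tcat)
      (f : mor A B) (g : mor B C) (h : mor C (shift A))
      (f' : mor A' B') (g' : mor B' C') (h' : mor C' (shift A'))
      (a : mor A A') (b : mor B B') (c : mor C C'),
    is_iso a -> is_iso b -> is_iso c ->
    b ∘ f = f' ∘ a -> c ∘ g = g' ∘ b -> shiftm a ∘ h = h' ∘ c ->
    dist f g h -> dist f' g' h';
  dist_id : forall A Z : tcat, idt Z = 0 ->
    dist (idt A) (0 : mor A Z) (0 : mor Z (shift A));
  dist_cone : forall (A B : tcat) (f : mor A B),
    exists C (g : mor B C) (h : mor C (shift A)), dist f g h;
  dist_rot : forall (A B C : tcat)
      (f : mor A B) (g : mor B C) (h : mor C (shift A)),
    dist f g h <-> dist g h (- shiftm f);
  dist_map : forall (A B C A' B' C' : tcat)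
      (f : mor A B) (g : mor B C) (h : mor C (shift A))
      (f' : mor A' B') (g' : mor B' C') (h' : mor C' (shift A'))
      (a : mor A A') (b : mor B B'),
    dist f g h -> dist f' g' h' -> b ∘ f = f' ∘ a ->
    exists c : mor C C', c ∘ g = g' ∘ b /\ shiftm a ∘ h = h' ∘ c;
  dist_octa : forall (X Y Z X' Y' Z' : tcat)
      (f : mor X Y) (f' : mor Y Z') (f'' : mor Z' (shift X))
      (g : mor Y Z) (g' : mor Z X') (g'' : mor X' (shift Y))
      (h' : mor Z Y') (h'' : mor Y' (shift X)),
    dist f f' f'' -> dist g g' g'' -> dist (g ∘ f) h' h'' ->
    exists (u : mor Z' Y') (v : mor Y' X'),
      [/\ dist u v (shiftm f' ∘ g''),
          u ∘ f' = h' ∘ g, v ∘ h' = g',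
          h'' ∘ u = f'' & shiftm f ∘ h'' = g'' ∘ v]
}.

Arguments shift {t} A.
Arguments shiftm {t A B} f.
Arguments dist {t A B C} f g h.

(* Extriangulated categories in the sense of Nakaoka--Palu.
   [Ext C A] is E(C, A), with [push a] = a_* and [pull c] = c^*.  The
   realization s is encoded by the predicate [realizes]: [realizes delta x y]
   means that the sequence (x, y) belongs to the class s(delta). *)
Record extriangulated_category := ExtriangulatedCategory {
  ecat :> additive_category;
  (* (ET1) *)
  Ext : ecat -> ecat -> zmodType;
  push : forall (C A A' : ecat), mor A A' -> Ext C A -> Ext C A';
  pull : forall (C C' A : ecat), mor C' C -> Ext C A -> Ext C' A;
  push1 : forall (C A : ecat) (e : Ext C A), push (idt A) e = e;
  pushM : forall (C A A' A'' : ecat) (b : mor A' A'') (a : mor A A')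
    (e : Ext C A), push (b ∘ a) e = push b (push a e);
  pull1 : forall (C A : ecat) (e : Ext C A), pull (idt C) e = e;
  pullM : forall (C C' C'' A : ecat) (c : mor C' C) (d : mor C'' C')
    (e : Ext C A), pull (c ∘ d) e = pull d (pull c e);
  push_pull : forall (C C' A A' : ecat) (a : mor A A') (c : mor C' C)
    (e : Ext C A), push a (pull c e) = pull c (push a e);
  pushDr : forall (C A A' : ecat) (a : mor A A') (e e' : Ext C A),
    push a (e + e') = push a e + push a e';
  pullDr : forall (C C' A : ecat) (c : mor C' C) (e e' : Ext C A),
    pull c (e + e') = pull c e + pull c e';
  pushDl : forall (C A A' : ecat) (a a' : mor A A') (e : Ext C A),
    push (a + a') e = push a e + push a' e;
  pullDl : forall (C C' A : ecat) (c c' : mor C' C) (e : Ext C A),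
    pull (c + c') e = pull c e + pull c' e;
  (* (ET2) *)
  realizes : forall (C A B : ecat), Ext C A -> mor A B -> mor B C -> Prop;
  realizes_ex : forall (C A : ecat) (e : Ext C A),
    exists B (x : mor A B) (y : mor B C), realizes e x y;
  realizes_equiv : forall (C A B B' : ecat) (e : Ext C A)
      (x : mor A B) (y : mor B C) (x' : mor A B') (y' : mor B' C),
    realizes e x y ->
    (realizes e x' y' <->
     exists b : mor B B', [/\ is_iso b, b ∘ x = x' & y' ∘ b = y]);
  realizes_map : forall (C A B C' A' B' : ecat) (e : Ext C A) (e' : Ext C' A')
      (x : mor A B) (y : mor B C) (x' : mor A' B') (y' : mor B' C')
      (a : mor A A') (c : mor C C'),
    realizes e x y -> realizes e' x' y' -> push a e = pull c e' ->
    exists b : mor B B', b ∘ x = x' ∘ a /\ y' ∘ b = c ∘ y;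
  realizes0 : forall (A C S : ecat)
      (iA : mor A S) (iC : mor C S) (pA : mor S A) (pC : mor S C),
    is_biproduct iA iC pA pC -> realizes 0 iA pC;
  realizesD : forall (C A B C' A' B' SA SB SC : ecat)
      (e : Ext C A) (e' : Ext C' A')
      (x : mor A B) (y : mor B C) (x' : mor A' B') (y' : mor B' C')
      (iA : mor A SA) (iA' : mor A' SA) (pA : mor SA A) (pA' : mor SA A')
      (iB : mor B SB) (iB' : mor B' SB) (pB : mor SB B) (pB' : mor SB B')
      (iC : mor C SC) (iC' : mor C' SC) (pC : mor SC C) (pC' : mor SC C'),
    is_biproduct iA iA' pA pA' -> is_biproduct iB iB' pB pB' ->
    is_biproduct iC iC' pC pC' ->
    realizes e x y -> realizes e' x' y' ->
    realizes (push iA (pull pC e) + push iA' (pull pC' e'))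
      (iB ∘ x ∘ pA + iB' ∘ x' ∘ pA') (iC ∘ y ∘ pB + iC' ∘ y' ∘ pB');
  (* (ET3), (ET3)^op *)
  et3 : forall (C A B C' A' B' : ecat) (e : Ext C A) (e' : Ext C' A')
      (x : mor A B) (y : mor B C) (x' : mor A' B') (y' : mor B' C')
      (a : mor A A') (b : mor B B'),
    realizes e x y -> realizes e' x' y' -> b ∘ x = x' ∘ a ->
    exists c : mor C C', c ∘ y = y' ∘ b /\ push a e = pull c e';
  et3op : forall (C A B C' A' B' : ecat) (e : Ext C A) (e' : Ext C' A')
      (x : mor A B) (y : mor B C) (x' : mor A' B') (y' : mor B' C')
      (b : mor B B') (c : mor C C'),
    realizes e x y -> realizes e' x' y' -> c ∘ y = y' ∘ b ->
    exists a : mor A A', b ∘ x = x' ∘ a /\ push a e = pull c e';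
  (* (ET4), (ET4)^op *)
  et4 : forall (A B C D F : ecat) (e : Ext D A) (e' : Ext F B)
      (f : mor A B) (f' : mor B D) (g : mor B C) (g' : mor C F),
    realizes e f f' -> realizes e' g g' ->
    exists E (d : mor D E) (u : mor E F) (h' : mor C E) (e'' : Ext E A),
      [/\ d ∘ f' = h' ∘ g, u ∘ h' = g' & realizes e'' (g ∘ f) h'] /\
      [/\ realizes (push f' e') d u, pull d e'' = e & push f e'' = pull u e'];
  et4op : forall (A B C D F : ecat) (e : Ext B D) (e' : Ext C F)
      (f' : mor D A) (f : mor A B) (g' : mor F B) (g : mor B C),
    realizes e f' f -> realizes e' g' g ->
    exists E (d : mor D E) (u : mor E F) (h' : mor E A) (e'' : Ext C E),
      [/\ h' ∘ d = f', f ∘ h' = g' ∘ u & realizes e'' h' (g ∘ f)] /\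
      [/\ realizes (pull g' e) d u, push u e'' = e' & push d e = pull g e'']
}.

Arguments Ext {_} C A.
Arguments push {_ C A A'} a _.
Arguments pull {_ C C' A} c _.
Arguments realizes {_ C A B} _ x y.

Section ExtriangulatedNotions.
Variable C : extriangulated_category.

Definition conflation (X Y Z : C) (x : mor X Y) (y : mor Y Z) : Prop :=
  exists e : Ext Z X, realizes e x y.

Definition conflation_obj (X Y Z : C) : Prop :=
  exists (x : mor X Y) (y : mor Y Z), conflation x y.

Definition projective (P : C) : Prop :=
  forall (X Y Z : C) (x : mor X Y) (y : mor Y Z), conflation x y ->
  forall c : mor P Z, exists b : mor P Y, y ∘ b = c.

Definition injective_obj (I : C) : Prop :=
  forall (X Y Z : C) (x : mor X Y) (y : mor Y Z), conflation x y ->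
  forall a : mor X I, exists b : mor Y I, b ∘ x = a.

Definition enough_projectives : Prop :=
  forall Z : C, exists X P : C, projective P /\ conflation_obj X P Z.

Definition gldim_le (m : nat) : Prop :=
  forall X0 : C, exists X P : nat -> C,
    [/\ X 0%N = X0,
        forall i, (1 <= i <= m)%N ->
          projective (P i) /\ conflation_obj (X i) (P i) (X i.-1)
      & projective (X m)].

Definition domdim_ge (m : nat) : Prop :=
  forall P : C, projective P -> exists X Q : nat -> C,
    [/\ X 1%N = P,
        forall i, (1 <= i <= m)%N ->
          [/\ projective (Q i), injective_obj (Q i)
            & conflation_obj (X i) (Q i) (X i.+1)]
      & injective_obj (X m.+1)].

Definition d_Auslander (d : nat) : Prop :=
  [/\ enough_projectives, gldim_le d.+1 & domdim_ge d.+1].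

End ExtriangulatedNotions.

(* A full subcategory is given by its class of objects. *)
Section ClusterTilting.
Variables (T : triangulated_category) (M : T -> Prop).

Definition contravariantly_finite : Prop :=
  forall X : T, exists N (f : mor N X), M N /\
    forall N' (f' : mor N' X), M N' -> exists h : mor N' N, f' = f ∘ h.

Definition covariantly_finite : Prop :=
  forall X : T, exists N (f : mor X N), M N /\
    forall N' (f' : mor X N'), M N' -> exists h : mor N N', f' = h ∘ f.

Definition functorially_finite : Prop :=
  contravariantly_finite /\ covariantly_finite.

Definition cluster_tilting (n : nat) : Prop :=
  [/\ functorially_finite,
      forall X, M X <->
        (forall N, M N -> forall i, (1 <= i < n)%N ->
           forall f : mor X (iter i shift N), f = 0)
    & forall X, M X <->
        (forall N, M N -> forall i, (1 <= i < n)%N ->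
           forall f : mor N (iter i shift X), f = 0)].

End ClusterTilting.

Section AdditiveFacts.
Variable C : additive_category.

Lemma mcomp0m (X Y Z : C) (f : mor X Y) : (0 : mor Y Z) ∘ f = 0.
Proof. by apply: (addrI (0 ∘ f)); rewrite -mcompDl !addr0. Qed.

Lemma mcompm0 (X Y Z : C) (g : mor Y Z) : g ∘ (0 : mor X Y) = 0.
Proof. by apply: (addrI (g ∘ 0)); rewrite -mcompDr !addr0. Qed.

Lemma mcompNm (X Y Z : C) (g : mor Y Z) (f : mor X Y) : (- g) ∘ f = - (g ∘ f).
Proof. by apply: (addrI (g ∘ f)); rewrite -mcompDl !subrr mcomp0m. Qed.

Lemma mcompmN (X Y Z : C) (g : mor Y Z) (f : mor X Y) : g ∘ (- f) = - (g ∘ f).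
Proof. by apply: (addrI (g ∘ f)); rewrite -mcompDr !subrr mcompm0. Qed.

Lemma mcompBr (X Y Z : C) (g : mor Y Z) (f f' : mor X Y) :
  g ∘ (f - f') = g ∘ f - g ∘ f'.
Proof. by rewrite mcompDr mcompmN. Qed.

Lemma is_iso1 (X : C) : is_iso (idt X).
Proof. by exists (idt X); rewrite !mcomp1m. Qed.

Lemma is_isoN1 (X : C) : is_iso (- idt X).
Proof. by exists (- idt X); rewrite !mcompNm !mcompmN !mcomp1m opprK. Qed.

Lemma biproduct_eqP (A B S X : C) (i1 : mor A S) (i2 : mor B S)
    (p1 : mor S A) (p2 : mor S B) (f g : mor X S) :
  is_biproduct i1 i2 p1 p2 -> p1 ∘ f = p1 ∘ g -> p2 ∘ f = p2 ∘ g -> f = g.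
Proof.
move=> H e1 e2; rewrite -[f]mcomp1m -[g]mcomp1m -(bp_sum H) !mcompDl.
by rewrite -!mcompA e1 e2.
Qed.

End AdditiveFacts.

Section TriangulatedFacts.
Variable T : triangulated_category.
Implicit Types A B C W : T.

Lemma shiftm0 A B : shiftm (0 : mor A B) = 0.
Proof. by apply: (addrI (shiftm 0)); rewrite -shiftmD !addr0. Qed.

Lemma shiftmN A B (f : mor A B) : shiftm (- f) = - shiftm f.
Proof. by apply: (addrI (shiftm f)); rewrite -shiftmD !subrr shiftm0. Qed.

Lemma shiftm_inj A B : injective (@shiftm T A B).
Proof. exact: bij_inj (shiftm_bij A B). Qed.

Lemma shiftm_surj A B (f : mor (shift A) (shift B)) : exists g, shiftm g = f.
Proof. by have [k _ kK] := shiftm_bij A B; exists (k f). Qed.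

Lemma dist_comp0 A B C (f : mor A B) (g : mor B C) h : dist f g h -> g ∘ f = 0.
Proof.
move=> D; have [Z Z0] := has_zero T.
have DZ : dist (idt A) (0 : mor A Z) 0 by apply: dist_id; exact: (Z0 Z).1.
have [|c [<- _]] := dist_map (a := idt A) (b := f) DZ D; first by [].
by rewrite mcompm0.
Qed.

Lemma dist_exact A B C (f : mor A B) (g : mor B C) h W (w : mor W B) :
  dist f g h -> g ∘ w = 0 -> exists v, w = f ∘ v.
Proof.
move=> D gw; have [Z Z0] := has_zero T.
have /dist_rot DZ : dist (idt W) (0 : mor W Z) 0.
  by apply: dist_id; exact: (Z0 Z).1.
have /dist_rot D' := D.
have [|c [_]] := dist_map (a := w) (b := 0 : mor Z C) DZ D'.
  by rewrite gw mcomp0m.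
have [v <-] := shiftm_surj c.
rewrite shiftm1 mcompmN mcompm1 mcompNm -shiftmM => /oppr_inj /shiftm_inj.
by exists v.
Qed.

Lemma dist_comp0r A B C (f : mor A B) (g : mor B C) h : dist f g h -> h ∘ g = 0.
Proof. by move=> /dist_rot /dist_comp0. Qed.

Lemma dist_comp0s A B C (f : mor A B) (g : mor B C) h :
  dist f g h -> shiftm f ∘ h = 0.
Proof.
move=> /dist_rot /dist_rot /dist_comp0 /eqP.
by rewrite mcompNm oppr_eq0 => /eqP.
Qed.

Lemma dist_exactr A B C (f : mor A B) (g : mor B C) h W (w : mor W C) :
  dist f g h -> h ∘ w = 0 -> exists v, w = g ∘ v.
Proof. by move=> /dist_rot; exact: dist_exact. Qed.

Lemma dist_exacts A B C (f : mor A B) (g : mor B C) h W (w : mor W (shift A)) :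
  dist f g h -> shiftm f ∘ w = 0 -> exists v, w = h ∘ v.
Proof.
move=> /dist_rot /dist_rot D e; apply: (dist_exact D).
by rewrite mcompNm e oppr0.
Qed.

(* A candidate triangle [(x, y, e)] which is exact enough and maps to a distinguished
   triangle by a morphism which is the identity on both ends is isomorphic
   to it. *)
Lemma mid_iso A B B' C (e : mor C (shift A))
    (x : mor A B) (y : mor B C) (x' : mor A B') (y' : mor B' C) (b : mor B B') :
  dist x' y' e -> b ∘ x = x' -> y' ∘ b = y ->
  (forall W (w : mor W C), e ∘ w = 0 -> exists v, w = y ∘ v) ->
  (forall W (w : mor W B), y ∘ w = 0 -> exists v, w = x ∘ v) ->
  shiftm x ∘ e = 0 -> is_iso b.
Proof.
move=> D bx yb exC exB xe.
have [s bs] : exists s, b ∘ s = idt B'.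
  have [|v yv] := exC _ y'; first exact: dist_comp0r D.
  have [|u ux] := dist_exact (w := idt B' - b ∘ v) D.
    by rewrite mcompBr mcompm1 mcompA yb -yv subrr.
  exists (v + x ∘ u).
  by rewrite mcompDr mcompA bx -ux addrC subrK.
exists s; split=> //.
have : b ∘ (s ∘ b - idt B) = 0.
  by rewrite mcompBr mcompA bs mcomp1m mcompm1 subrr.
move=> bw; apply/eqP; rewrite -subr_eq0; apply/eqP; move: bw.
move: (s ∘ b - idt B) => w bw.
have [|u wu] := exB _ w; first by rewrite -yb -mcompA bw mcompm0.
have x'u : x' ∘ u = 0 by rewrite -bx -mcompA -wu.
have [|t ut] := dist_exacts (w := shiftm u) D; first by rewrite -shiftmM x'u shiftm0.
by apply: shiftm_inj; rewrite wu shiftmM ut mcompA xe mcomp0m shiftm0.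
Qed.

Lemma mid_dist A B B' C (e : mor C (shift A))
    (x : mor A B) (y : mor B C) (x' : mor A B') (y' : mor B' C) (b : mor B B') :
  is_iso b -> dist x y e -> b ∘ x = x' -> y' ∘ b = y -> dist x' y' e.
Proof.
move=> ib D bx yb; apply: (dist_iso (a := idt _) (b := b) (c := idt _)) D.
- exact: is_iso1.
- exact: ib.
- exact: is_iso1.
- by rewrite mcompm1.
- by rewrite mcomp1m.
- by rewrite shiftm1 mcomp1m mcompm1.
Qed.

Lemma mid_dist_inv A B B' C (e : mor C (shift A))
    (x : mor A B) (y : mor B C) (x' : mor A B') (y' : mor B' C) (b : mor B B') :
  is_iso b -> dist x' y' e -> b ∘ x = x' -> y' ∘ b = y -> dist x y e.
Proof.
case=> s [sb bs] D bx yb; apply: (@mid_dist _ _ _ _ _ _ _ _ _ s _ D).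
- by exists b.
- by rewrite -bx mcompA sb mcomp1m.
- by rewrite -yb -mcompA bs mcompm1.
Qed.

Lemma dist_fiber A C (e : mor C (shift A)) :
  exists B (x : mor A B) (y : mor B C), dist x y e.
Proof.
have [W [u [v D]]] := dist_cone e.
have [B [phi [psi [psiK phiK]]]] := shift_esurj W.
have [x xE] := shiftm_surj (- (psi ∘ u)).
have [y yE] := shiftm_surj (- (v ∘ phi)).
exists B, x, y; apply/dist_rot/dist_rot.
rewrite xE yE !opprK.
apply: (dist_iso (a := idt _) (b := idt _) (c := psi)) D.
- exact: is_iso1.
- exact: is_iso1.
- by exists phi; split; [exact: phiK | exact: psiK].
- by rewrite mcomp1m mcompm1.
- by rewrite mcompm1.
- by rewrite shiftm1 mcomp1m -mcompA phiK mcompm1.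
Qed.

Lemma dist_map_mid A B C A' B' C' (e : mor C (shift A)) (e' : mor C' (shift A'))
    (x : mor A B) (y : mor B C) (x' : mor A' B') (y' : mor B' C')
    (a : mor A A') (c : mor C C') :
  dist x y e -> dist x' y' e' -> shiftm a ∘ e = e' ∘ c ->
  exists b : mor B B', b ∘ x = x' ∘ a /\ y' ∘ b = c ∘ y.
Proof.
move=> /dist_rot /dist_rot D /dist_rot /dist_rot D' E.
have [c' []] := dist_map D D' E.
have [b <-] := shiftm_surj c'.
rewrite mcompmN mcompNm -!shiftmM => /oppr_inj /shiftm_inj e1.
rewrite mcompmN mcompNm -!shiftmM => /oppr_inj /shiftm_inj e2.
by exists b.
Qed.

Lemma dist_map_fst A B C A' B' C' (e : mor C (shift A)) (e' : mor C' (shift A'))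
    (x : mor A B) (y : mor B C) (x' : mor A' B') (y' : mor B' C')
    (b : mor B B') (c : mor C C') :
  dist x y e -> dist x' y' e' -> c ∘ y = y' ∘ b ->
  exists a : mor A A', b ∘ x = x' ∘ a /\ shiftm a ∘ e = e' ∘ c.
Proof.
move=> /dist_rot D /dist_rot D' E.
have [c' []] := dist_map D D' E.
have [a <-] := shiftm_surj c' => e1.
rewrite mcompmN mcompNm -!shiftmM => /oppr_inj /shiftm_inj e2.
by exists a.
Qed.

Lemma dist_equiv A B B' C (e : mor C (shift A))
    (x : mor A B) (y : mor B C) (x' : mor A B') (y' : mor B' C) :
  dist x y e ->
  (dist x' y' e <-> exists b : mor B B', [/\ is_iso b, b ∘ x = x' & y' ∘ b = y]).
Proof.
move=> D; split=> [D' | [b [ib bx yb]]]; last exact: mid_dist ib D bx yb.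
have [|b []] := dist_map_mid (a := idt A) (c := idt C) D D'.
  by rewrite shiftm1 mcomp1m mcompm1.
rewrite mcompm1 mcomp1m => bx yb; exists b; split=> //.
apply: (mid_iso D' bx yb) => [W w|W w|].
- exact: dist_exactr D.
- exact: dist_exact D.
- exact: dist_comp0s D.
Qed.

Lemma dist_split A C S
    (iA : mor A S) (iC : mor C S) (pA : mor S A) (pC : mor S C) :
  is_biproduct iA iC pA pC -> dist iA pC 0.
Proof.
move=> H; have [B [x [y D]]] := dist_fiber (0 : mor C (shift A)).
have [|s ys] := dist_exactr (w := idt C) D; first by rewrite mcomp0m.
have e1 : (x ∘ pA + s ∘ pC) ∘ iA = x.
  by rewrite mcompDl -!mcompA (bp11 H) (bp21 H) mcompm1 mcompm0 addr0.
have e2 : y ∘ (x ∘ pA + s ∘ pC) = pC.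
  by rewrite mcompDr !mcompA (dist_comp0 D) -ys mcomp0m mcomp1m add0r.
apply: (mid_dist_inv _ D e1 e2); apply: (mid_iso D e1 e2) => [W w _|W w w0|].
- by exists (iC ∘ w); rewrite mcompA (bp22 H) mcomp1m.
- exists (pA ∘ w); rewrite -[LHS]mcomp1m -(bp_sum H) mcompDl -!mcompA w0.
  by rewrite mcompm0 addr0.
- by rewrite mcompm0.
Qed.

Lemma dist_sum A B C A' B' C' SA SB SC
    (e : mor C (shift A)) (e' : mor C' (shift A'))
    (x : mor A B) (y : mor B C) (x' : mor A' B') (y' : mor B' C')
    (iA : mor A SA) (iA' : mor A' SA) (pA : mor SA A) (pA' : mor SA A')
    (iB : mor B SB) (iB' : mor B' SB) (pB : mor SB B) (pB' : mor SB B')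
    (iC : mor C SC) (iC' : mor C' SC) (pC : mor SC C) (pC' : mor SC C') :
  is_biproduct iA iA' pA pA' -> is_biproduct iB iB' pB pB' ->
  is_biproduct iC iC' pC pC' ->
  dist x y e -> dist x' y' e' ->
  dist (iB ∘ x ∘ pA + iB' ∘ x' ∘ pA') (iC ∘ y ∘ pB + iC' ∘ y' ∘ pB')
    (shiftm iA ∘ (e ∘ pC) + shiftm iA' ∘ (e' ∘ pC')).
Proof.
move=> HA HB HC D D'.
set E := shiftm iA ∘ _ + _; set X := iB ∘ x ∘ pA + _; set Y := iC ∘ y ∘ pB + _.
have EC : E ∘ iC = shiftm iA ∘ e.
  by rewrite mcompDl -!mcompA (bp11 HC) (bp21 HC) mcompm1 !mcompm0 addr0.
have EC' : E ∘ iC' = shiftm iA' ∘ e'.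
  by rewrite mcompDl -!mcompA (bp12 HC) (bp22 HC) mcompm1 !mcompm0 add0r.
have pY : pC ∘ Y = y ∘ pB.
  by rewrite mcompDr !mcompA (bp11 HC) (bp12 HC) mcomp1m !mcomp0m addr0.
have pY' : pC' ∘ Y = y' ∘ pB'.
  by rewrite mcompDr !mcompA (bp21 HC) (bp22 HC) mcomp1m !mcomp0m add0r.
have pX : pB ∘ X = x ∘ pA.
  by rewrite mcompDr !mcompA (bp11 HB) (bp12 HB) mcomp1m !mcomp0m addr0.
have pX' : pB' ∘ X = x' ∘ pA'.
  by rewrite mcompDr !mcompA (bp21 HB) (bp22 HB) mcomp1m !mcomp0m add0r.
have sE : shiftm pA ∘ E = e ∘ pC.
  by rewrite mcompDr !mcompA -!shiftmM (bp11 HA) (bp12 HA) shiftm1 shiftm0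
             mcomp1m !mcomp0m addr0.
have sE' : shiftm pA' ∘ E = e' ∘ pC'.
  by rewrite mcompDr !mcompA -!shiftmM (bp21 HA) (bp22 HA) shiftm1 shiftm0
             mcomp1m !mcomp0m add0r.
have [Z [u [v DZ]]] := dist_fiber E.
have [b1 [b1x b1y]] := dist_map_mid D DZ (esym EC).
have [b2 [b2x b2y]] := dist_map_mid D' DZ (esym EC').
have e1 : (b1 ∘ pB + b2 ∘ pB') ∘ X = u.
  rewrite mcompDl -!mcompA pX pX' !mcompA b1x b2x -!mcompA -mcompDr (bp_sum HA).
  by rewrite mcompm1.
have e2 : v ∘ (b1 ∘ pB + b2 ∘ pB') = Y by rewrite mcompDr !mcompA b1y b2y.
apply: (mid_dist_inv _ DZ e1 e2); apply: (mid_iso DZ e1 e2) => [W w w0|W w w0|].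
- have [|t1 t1E] := dist_exactr (w := pC ∘ w) D.
    by rewrite mcompA -sE -mcompA w0 mcompm0.
  have [|t2 t2E] := dist_exactr (w := pC' ∘ w) D'.
    by rewrite mcompA -sE' -mcompA w0 mcompm0.
  exists (iB ∘ t1 + iB' ∘ t2); apply: (biproduct_eqP HC).
    by rewrite mcompA pY mcompDr -!mcompA !(mcompA pB) (bp11 HB) (bp12 HB)
               mcomp1m mcomp0m mcompm0 addr0.
  by rewrite mcompA pY' mcompDr -!mcompA !(mcompA pB') (bp21 HB) (bp22 HB)
             mcomp1m mcomp0m mcompm0 add0r.
- have [|t1 t1E] := dist_exact (w := pB ∘ w) D.
    by rewrite mcompA -pY -mcompA w0 mcompm0.
  have [|t2 t2E] := dist_exact (w := pB' ∘ w) D'.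
    by rewrite mcompA -pY' -mcompA w0 mcompm0.
  exists (iA ∘ t1 + iA' ∘ t2); apply: (biproduct_eqP HB).
    by rewrite mcompA pX mcompDr -!mcompA !(mcompA pA) (bp11 HA) (bp12 HA)
               mcomp1m mcomp0m mcompm0 addr0.
  by rewrite mcompA pX' mcompDr -!mcompA !(mcompA pA') (bp21 HA) (bp22 HA)
             mcomp1m mcomp0m mcompm0 add0r.
- rewrite mcompDr !mcompA -!shiftmM.
  have -> : X ∘ iA = iB ∘ x.
    by rewrite mcompDl -!mcompA (bp11 HA) (bp21 HA) mcompm1 !mcompm0 addr0.
  have -> : X ∘ iA' = iB' ∘ x'.
    by rewrite mcompDl -!mcompA (bp12 HA) (bp22 HA) mcompm1 !mcompm0 add0r.
  rewrite !shiftmM -!(mcompA _ (shiftm _)) (dist_comp0s D) (dist_comp0s D').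
  by rewrite !mcompm0 !mcomp0m addr0.
Qed.

Lemma dist_octa_dual A B C D F (e : mor B (shift D)) (e' : mor C (shift F))
    (f' : mor D A) (f : mor A B) (g' : mor F B) (g : mor B C) :
  dist f' f e -> dist g' g e' ->
  exists E (d : mor D E) (u : mor E F) (h' : mor E A) (e'' : mor C (shift E)),
    [/\ h' ∘ d = f', f ∘ h' = g' ∘ u & dist h' (g ∘ f) e''] /\
    [/\ dist d u (e ∘ g'), shiftm u ∘ e'' = e' & shiftm d ∘ e = e'' ∘ g].
Proof.
move=> /dist_rot D1 /dist_rot D2.
have [Z [k [l D3]]] := dist_cone (g ∘ f).
have [u0 [v0 [D4 uE vE luE flE]]] := dist_octa D1 D2 D3.
have [E [phi [psi [psiK phiK]]]] := shift_esurj Z.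
have [h' hE] := shiftm_surj (- (l ∘ phi)).
have [d dE] := shiftm_surj (psi ∘ u0).
have [u wE] := shiftm_surj (v0 ∘ phi).
exists E, d, u, h', (psi ∘ k); split; split.
- apply: shiftm_inj; rewrite shiftmM hE dE mcompNm -mcompA (mcompA phi) phiK.
  by rewrite mcomp1m luE opprK.
- apply: shiftm_inj; rewrite !shiftmM hE wE mcompmN mcompA flE !mcompNm opprK.
  by rewrite mcompA.
- apply/dist_rot; rewrite hE opprK.
  apply: (dist_iso (a := idt _) (b := idt _) (c := psi)) D3.
  + exact: is_iso1.
  + exact: is_iso1.
  + by exists phi; split; [exact: phiK | exact: psiK].
  + by rewrite mcomp1m mcompm1.
  + by rewrite mcompm1.
  + by rewrite shiftm1 mcomp1m -mcompA phiK mcompm1.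
- apply/dist_rot/dist_rot/dist_rot; rewrite dE wE.
  apply: (dist_iso (a := idt _) (b := - psi) (c := idt _)) D4.
  + exact: is_iso1.
  + by exists (- phi); rewrite !mcompNm !mcompmN !opprK.
  + exact: is_iso1.
  + by rewrite mcompm1 mcompNm.
  + by rewrite mcompNm mcompmN opprK mcomp1m -mcompA phiK mcompm1.
  + by rewrite shiftm1 mcomp1m mcompm1 mcompmN shiftmM.
- by rewrite wE -mcompA (mcompA phi) phiK mcomp1m.
- by rewrite dE -!mcompA uE.
Qed.

End TriangulatedFacts.

Section RelativeExt.
Variables (T : triangulated_category) (M : T -> Prop).

Definition rel_pred (C A : T) : pred (mor C (shift A)) :=
  fun e => `[< forall N (f : mor N C), M N -> e ∘ f = 0 >].
Arguments rel_pred : clear implicits.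

Lemma rel_predP (C A : T) (e : mor C (shift A)) :
  reflect (forall N (f : mor N C), M N -> e ∘ f = 0) (e \in rel_pred C A).
Proof. exact: asboolP. Qed.

Lemma rel_pred_closed (C A : T) : zmod_closed (rel_pred C A).
Proof.
split=> [|e e' /rel_predP He /rel_predP He'].
  by apply/rel_predP => N f _; rewrite mcomp0m.
by apply/rel_predP => N f MN; rewrite mcompDl mcompNm He ?He' ?subrr.
Qed.

HB.instance Definition _ (C A : T) :=
  GRing.isZmodClosed.Build _ (rel_pred C A) (rel_pred_closed C A).

(* The abelian group E_M(C, A), a subgroup of Hom(C, Sigma A). *)
Record rel_ext (C A : T) := RelExt {
  rel_val :> mor C (shift A);
  rel_valP : rel_val \in rel_pred C A
}.

HB.instance Definition _ (C A : T) := [isSub for @rel_val C A].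
HB.instance Definition _ (C A : T) := [Choice of rel_ext C A by <:].
HB.instance Definition _ (C A : T) :=
  [SubChoice_isSubZmodule of rel_ext C A by <:].

Lemma rel_push_subproof (C A A' : T) (a : mor A A') (e : rel_ext C A) :
  shiftm a ∘ e \in rel_pred C A'.
Proof.
apply/rel_predP => N f MN.
by rewrite -mcompA (rel_predP _ (rel_valP e)) // mcompm0.
Qed.

Lemma rel_pull_subproof (C C' A : T) (c : mor C' C) (e : rel_ext C A) :
  rel_val e ∘ c \in rel_pred C' A.
Proof.
by apply/rel_predP => N f MN; rewrite -mcompA (rel_predP _ (rel_valP e)).
Qed.

Definition rel_push (C A A' : T) (a : mor A A') (e : rel_ext C A) :
  rel_ext C A' := RelExt (rel_push_subproof a e).

Definition rel_pull (C C' A : T) (c : mor C' C) (e : rel_ext C A) :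
  rel_ext C' A := RelExt (rel_pull_subproof c e).

Definition rel_realizes (C A B : T) (e : rel_ext C A)
    (x : mor A B) (y : mor B C) : Prop := dist x y (rel_val e).

Lemma rel_et4 (A B C D F : T) (e : rel_ext D A) (e' : rel_ext F B)
    (f : mor A B) (f' : mor B D) (g : mor B C) (g' : mor C F) :
  rel_realizes e f f' -> rel_realizes e' g g' ->
  exists E (d : mor D E) (u : mor E F) (h' : mor C E) (e'' : rel_ext E A),
    [/\ d ∘ f' = h' ∘ g, u ∘ h' = g' & rel_realizes e'' (g ∘ f) h'] /\
    [/\ rel_realizes (rel_push f' e') d u, rel_pull d e'' = e
      & rel_push f e'' = rel_pull u e'].
Proof.
move=> D1 D2; have [E [h' [h'' D3]]] := dist_cone (g ∘ f).
have [d [u [D4 e1 e2 e3 e4]]] := dist_octa D1 D2 D3.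
have Hh : h'' \in rel_pred E A.
  apply/rel_predP => N m MN.
  have [|k ->] := dist_exacts (w := h'' ∘ m) D1.
    by rewrite mcompA e4 -mcompA (rel_predP _ (rel_valP e')).
  exact: (rel_predP _ (rel_valP e)).
exists E, d, u, h', (RelExt Hh); do 2!split=> //.
- exact: val_inj.
- exact: val_inj.
Qed.

Lemma rel_et4op (A B C D F : T) (e : rel_ext B D) (e' : rel_ext C F)
    (f' : mor D A) (f : mor A B) (g' : mor F B) (g : mor B C) :
  rel_realizes e f' f -> rel_realizes e' g' g ->
  exists E (d : mor D E) (u : mor E F) (h' : mor E A) (e'' : rel_ext C E),
    [/\ h' ∘ d = f', f ∘ h' = g' ∘ u & rel_realizes e'' h' (g ∘ f)] /\
    [/\ rel_realizes (rel_pull g' e) d u, rel_push u e'' = e'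
      & rel_push d e = rel_pull g e''].
Proof.
move=> D1 D2.
have [E [d [u [h' [e'' [[e1 e2 D3] [D4 e3 e4]]]]]]] := dist_octa_dual D1 D2.
have He : e'' \in rel_pred C E.
  apply/rel_predP => N m MN.
  have [|n ->] := dist_exactr (w := m) D2.
    exact: (rel_predP _ (rel_valP e')).
  by rewrite mcompA -e4 -mcompA (rel_predP _ (rel_valP e)) // mcompm0.
exists E, d, u, h', (RelExt He); do 2!split=> //.
- exact: val_inj.
- exact: val_inj.
Qed.

Definition rel_extriangulated : extriangulated_category.
Proof.
refine (@ExtriangulatedCategory (tcat T) rel_ext rel_push rel_pull
  _ _ _ _ _ _ _ _ _ rel_realizes _ _ _ _ _ _ _ rel_et4 rel_et4op).
- by move=> C A e; apply: val_inj; rewrite /= shiftm1 mcomp1m.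
- by move=> C A A' A'' b a e; apply: val_inj; rewrite /= shiftmM mcompA.
- by move=> C A e; apply: val_inj; rewrite /= mcompm1.
- by move=> C C' C'' A c d e; apply: val_inj; rewrite /= mcompA.
- by move=> C C' A A' a c e; apply: val_inj; rewrite /= mcompA.
- by move=> C A A' a e e'; apply: val_inj; rewrite /= mcompDr.
- by move=> C C' A c e e'; apply: val_inj; rewrite /= mcompDl.
- by move=> C A A' a a' e; apply: val_inj; rewrite /= shiftmD mcompDl.
- by move=> C C' A c c' e; apply: val_inj; rewrite /= mcompDr.
- by move=> C A e; exact: dist_fiber.
- by move=> C A B B' e x y x' y'; exact: dist_equiv.
- move=> C A B C' A' B' e e' x y x' y' a c D D' /(congr1 (@rel_val _ _)).
  exact: dist_map_mid D D'.
- by move=> A C S iA iC pA pC; exact: dist_split.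
- move=> C A B C' A' B' SA SB SC e e' x y x' y'.
  by move=> iA iA' pA pA' iB iB' pB pB' iC iC' pC pC'; exact: dist_sum.
- move=> C A B C' A' B' e e' x y x' y' a b D D' E.
  have [c [e1 e2]] := dist_map D D' E.
  by exists c; split=> //; exact: val_inj.
- move=> C A B C' A' B' e e' x y x' y' b c D D' E.
  have [a [e1 e2]] := dist_map_fst D D' E.
  by exists a; split=> //; exact: val_inj.
Defined.

End RelativeExt.

(* Main.v *)
Require Import Defs.
From mathcomp Require Import all_boot all_algebra boolp.

(** The projectives of the relative structure are exactly the objects of [M]:
    an extension in E_M is killed by every map from [M], so maps out of [M]
    lift along deflations; conversely, the connecting map of a right
    [M]-approximation [N -> P] is such an extension, so a projective [P] is a
    direct summand of [N], hence lies in [M] ([projective_in]).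

    Global dimension: take a right [M]-approximation [N -> X] with cocone [K].
    In the long exact sequence Hom(M, -) of this triangle, Hom(M, Sigma^j N)
    vanishes for 1 <= j <= d+1, and N -> X is surjective on Hom(M, -).  So if
    Hom(M, Sigma^j X) = 0 for 1 <= j <= k, then Hom(M, Sigma^j K) = 0 for
    1 <= j <= k+1 ([syzygy_ext_vanish]).  After d+1 steps the syzygy satisfies
    all the vanishing conditions that characterize [M].

    Dominant dimension: for [P] in [M], the triangles
    Sigma^i P -> 0 -> Sigma^(i+1) P with connecting map minus the identity are
    conflations for 0 <= i <= d, because Hom(M, Sigma^(i+1) P) = 0.  Zero is
    projective-injective, so it only remains to see that Sigma^(d+1) P is
    injective.  This is dimension shifting along the same approximations: an
    extension of [X] by Sigma^(d+1) P factors through the connecting map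
    X -> Sigma K, giving an extension of [K] by Sigma^d P, again killed by [M]
    as Hom(M, Sigma^(d+1) P) = 0, and so on until the syzygy lies in [M] and
    the extension is therefore zero ([rel_ext_vanish]). *)

Set Implicit Arguments.
Unset Strict Implicit.
Unset Printing Implicit Defensive.
Import GRing.Theory.
Local Open Scope ring_scope.
Local Open Scope cat_scope.

Section Triangles.
Variable T : triangulated_category.
Implicit Types A B C W Z : T.

(** Obtained by mapping the triangle to the trivial triangle 0 -> W -> W. *)
Lemma dist_coexact A B C (f : mor A B) (g : mor B C) h W (w : mor B W) :
  dist f g h -> w ∘ f = 0 -> exists v, w = v ∘ g.
Proof.
move=> D wf; have [Z Z0] := has_zero T.
have DW : dist (0 : mor Z W) (idt W) 0.
  apply: (dist_rot _ _ _).2; rewrite shiftm0 oppr0; apply: dist_id.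
  by rewrite -shiftm1 [idt Z](Z0 Z).1 shiftm0.
have [|v [vg _]] := dist_map (a := 0 : mor A Z) (b := w) D DW.
  by rewrite wf mcomp0m.
by exists v; rewrite vg mcomp1m.
Qed.

Lemma dist_zero_mid A Z : idt Z = 0 ->
  dist (0 : mor A Z) (0 : mor Z (shift A)) (- idt (shift A)).
Proof.
by move=> Z0; rewrite -shiftm1; apply: (dist_rot _ _ _).1; exact: dist_id.
Qed.

(** Every map is the second one of a triangle: desuspend its cone. *)
Lemma dist_cocone A B (f : mor A B) :
  exists K (x : mor K A) (e : mor B (shift K)), dist x f e.
Proof.
have [W [g [h D]]] := dist_cone f.
have [K [phi [psi [psiK phiK]]]] := shift_esurj W.
have [x xE] := shiftm_surj (- (h ∘ phi)).
exists K, x, (psi ∘ g); apply/dist_rot; rewrite xE opprK.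
apply: (dist_iso (a := idt _) (b := idt _) (c := psi)) D.
- exact: is_iso1.
- exact: is_iso1.
- by exists phi.
- by rewrite mcomp1m mcompm1.
- by rewrite mcompm1.
- by rewrite shiftm1 mcomp1m -mcompA phiK mcompm1.
Qed.

Lemma dist_shift A B C (f : mor A B) (g : mor B C) h :
  dist f g h -> dist (- shiftm f) (- shiftm g) (- shiftm h).
Proof. by move=> /dist_rot /dist_rot /dist_rot. Qed.

(** Leaving the maps unspecified avoids the signs and the identification of
    Sigma^j Sigma A with Sigma Sigma^j A. *)
Lemma dist_iter_shift j A B C (f : mor A B) (g : mor B C) h :
  dist f g h ->
  exists (f' : mor (iter j shift A) (iter j shift B))
    (g' : mor (iter j shift B) (iter j shift C)) h', dist f' g' h'.
Proof.
move=> D; elim: j => [|j [f' [g' [h' D']]]]; first by exists f, g, h.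
by exists (- shiftm f'), (- shiftm g'), (- shiftm h'); exact: dist_shift.
Qed.

End Triangles.

Section Relative.
Variables (T : triangulated_category) (M : T -> Prop).
Implicit Types A B C K N P X : T.

Definition kills_M X Y (e : mor X Y) : Prop :=
  forall N (f : mor N X), M N -> e ∘ f = 0.

Lemma kills_M_conflation A B C (x : mor A B) (y : mor B C) e :
  dist x y e -> kills_M e ->
  conflation_obj (C := rel_extriangulated M) A B C.
Proof.
move=> D Ke; have He : e \in @rel_pred T M C A by apply/rel_predP.
by exists x, y, (RelExt He).
Qed.

Lemma in_projective P : M P -> projective (C := rel_extriangulated M) P.
Proof.
move=> MP X Y Z x y [e D] c.
have [|b ->] := dist_exactr (w := c) D; last by exists b.
exact: (rel_predP M (rel_val e) (rel_valP e)).
Qed.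

Lemma zero_projective Z : (forall A (f : mor Z A), f = 0) ->
  projective (C := rel_extriangulated M) Z.
Proof.
by move=> Z0 X Y W x y _ c; exists 0; rewrite [RHS]Z0; exact: mcompm0.
Qed.

Lemma zero_injective Z : (forall A (f : mor A Z), f = 0) ->
  injective_obj (C := rel_extriangulated M) Z.
Proof.
by move=> Z0 X Y W x y _ a; exists 0; rewrite [RHS]Z0; exact: mcomp0m.
Qed.

(** Along a conflation with extension class [e], a map [a] extends as soon as
    the pushforward of [e] along [a] is zero, since the triangle then maps to
    I -> I -> 0 with first component [a]. *)
Lemma rel_ext0_injective (I : T) :
  (forall C (e : mor C (shift I)), kills_M e -> e = 0) ->
  injective_obj (C := rel_extriangulated M) I.
Proof.
move=> I0 X Y W x y [e D] a; have [Z Z0] := has_zero T.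
have DI : dist (idt I) (0 : mor I Z) 0 by apply: dist_id; exact: (Z0 Z).1.
have ae0 : shiftm a ∘ rel_val e = 0.
  apply: I0; exact: (rel_predP M _ (rel_valP (rel_push a e))).
have [|b [bx _]] := dist_map_mid (a := a) (c := 0 : mor W Z) D DI.
  by rewrite ae0 mcomp0m.
by exists b; rewrite [LHS]bx mcomp1m.
Qed.

Definition ext_vanish k X : Prop :=
  forall N, M N -> forall j, (1 <= j <= k)%N ->
  forall f : mor N (iter j shift X), f = 0.

End Relative.

Section ClusterTilted.
Variables (d : nat) (T : triangulated_category) (M : T -> Prop).
Hypothesis hM : cluster_tilting M d.+2.
Implicit Types A B C K N P X : T.

Lemma in_ext_vanish P : M P -> ext_vanish M d.+1 P.
Proof. by case: hM => _ _ h /h H N MN j Hj; apply: H; rewrite // ltnS. Qed.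

Lemma ext_vanish_in P : ext_vanish M d.+1 P -> M P.
Proof. by case: hM => _ _ h H; apply/h => N MN j Hj; apply: H. Qed.

Lemma in_summand N P (f : mor N P) (s : mor P N) :
  M N -> f ∘ s = idt P -> M P.
Proof.
case: hM => _ h _ /h H fs; apply/h => N' MN' i Hi g.
by rewrite -(mcompm1 g) -fs mcompA [g ∘ f]H // mcomp0m.
Qed.

(** A right [M]-approximation, completed to a triangle: surjectivity on maps
    from [M] says exactly that the connecting map is killed by [M]. *)
Lemma approximation X : exists K N (x : mor K N) (y : mor N X) e,
  [/\ M N, dist x y e & kills_M M e].
Proof.
case: hM => [[contra _] _ _]; have [N [y [MN app]]] := contra X.
have [K [x [e D]]] := dist_cocone y.
exists K, N, x, y, e; split=> // N' f MN'.
by have [s ->] := app N' f MN'; rewrite mcompA (dist_comp0r D) mcomp0m.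
Qed.

Lemma projective_in P : projective (C := rel_extriangulated M) P -> M P.
Proof.
move=> projP; have [K [N [x [y [e [MN D Ke]]]]]] := approximation P.
have He : e \in @rel_pred T M P K by apply/rel_predP.
have [|s ys] := projP K N P x y _ (idt P); first by exists (RelExt He).
exact: in_summand MN ys.
Qed.

(** The case j = 1 uses that the connecting map is killed by [M], the cases
    j > 1 the vanishing of maps from [M] to Sigma^(j-1) X; in both cases a map
    to Sigma^j K factors through the connecting map because it dies in
    Sigma^j N. *)
Lemma syzygy_ext_vanish k X K N (x : mor K N) (y : mor N X) e :
  (k <= d)%N -> M N -> dist x y e -> kills_M M e ->
  ext_vanish M k X -> ext_vanish M k.+1 K.
Proof.
move=> kd MN D Ke VX N' MN' [//|j] /andP[_ jk] f.
have [x' [y' [e' [D' Ke']]]] : exists (x' : mor (iter j shift K) _)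
    (y' : mor (iter j shift N) (iter j shift X)) e', dist x' y' e' /\ kills_M M e'.
  case: j jk f => [|j] jk _; first by exists x, y, e.
  have [x' [y' [e' D']]] := dist_iter_shift j.+1 D; exists x', y', e'.
  by split=> // N1 g MN1; rewrite [g](VX N1 MN1 j.+1) ?mcompm0.
have [|g ->] := dist_exacts (w := f) D'; last exact: Ke'.
apply: (in_ext_vanish MN MN' (j := j.+1)).
by rewrite /= (leq_trans jk).
Qed.

(** Dimension shifting along [M]-approximations: [k] counts the vanishing
    conditions that [X] already satisfies and [m] the syzygies still to be
    taken before landing in [M]. *)
Lemma rel_ext_vanish m k X P (e : mor X (iter m.+1 shift P)) :
  M P -> (m + k = d.+1)%N -> ext_vanish M k X -> kills_M M e -> e = 0.
Proof.
move=> MP; elim: m k X e => [|m IHm] k X e mk VX Ke.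
  have MX : M X by apply: ext_vanish_in; rewrite -mk add0n.
  by rewrite -(mcompm1 e); exact: Ke.
have [K [N [x [y [h [MN D Kh]]]]]] := approximation X.
have /dist_rot D' := D.
have [|v ev] := dist_coexact (w := e) D'; first exact: Ke.
have [e' e'v] := shiftm_surj v.
have kd : (k <= d)%N by rewrite -ltnS -mk addSn ltnS leq_addl.
suff e'0 : e' = 0 by rewrite ev -e'v e'0 shiftm0 mcomp0m.
apply: (IHm k.+1); first by rewrite addnS -addSn.
  exact: syzygy_ext_vanish MN D Kh VX.
move=> N' f MN'; apply: (in_ext_vanish MP MN' (j := m.+1)).
by rewrite /= -mk leq_addr.
Qed.

Lemma top_shift_injective P : M P ->
  injective_obj (C := rel_extriangulated M) (iter d.+1 shift P).
Proof.
move=> MP; apply: rel_ext0_injective => C e.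
apply: (@rel_ext_vanish d.+1 0 _ _ _ MP); first by rewrite addn0.
by move=> N _ [|j].
Qed.

Lemma rel_enough_projectives : enough_projectives (rel_extriangulated M).
Proof.
move=> Z; have [K [N [x [y [e [MN D Ke]]]]]] := approximation Z.
exists K, N; split; [exact: in_projective | exact: kills_M_conflation D Ke].
Qed.

Lemma rel_gldim : gldim_le (rel_extriangulated M) d.+1.
Proof.
move=> X0.
have [S HS] := choice approximation; have [Q HQ] := choice HS.
pose X i := iter i S X0; exists X, (fun i => Q (X i.-1)).
have VX i : (i <= d.+1)%N -> ext_vanish M i (X i).
  elim: i => [|i IHi] Hi; first by move=> N _ [|j].
  have [x [y [e [MN D Ke]]]] := HQ (X i).
  exact: syzygy_ext_vanish Hi MN D Ke (IHi (ltnW Hi)).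
split=> // [[//|i] _|].
  have [x [y [e [MN D Ke]]]] := HQ (X i).
  by split; [exact: in_projective | exact: kills_M_conflation D Ke].
by apply/in_projective/ext_vanish_in/VX.
Qed.

Lemma rel_domdim : domdim_ge (rel_extriangulated M) d.+1.
Proof.
move=> P /projective_in MP; have [Z Z0] := has_zero T.
exists (fun i => iter i.-1 shift P), (fun=> Z); split=> //.
  move=> [//|i] /andP[_ Hi]; split.
  - by apply: zero_projective => A; exact: (Z0 A).2.
  - by apply: zero_injective => A; exact: (Z0 A).1.
  - apply: kills_M_conflation (dist_zero_mid _ ((Z0 Z).1 _)) _ => N f MN.
    by rewrite [f](in_ext_vanish MP MN (j := i.+1)) ?mcompm0.
exact: top_shift_injective.
Qed.

End ClusterTilted.

Theorem proposition5p1 (d : nat) (T : triangulated_category) (M : T -> Prop)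
    (hM : cluster_tilting M d.+2) :
  d_Auslander (rel_extriangulated M) d.
Proof.
split.
- exact: rel_enough_projectives hM.
- exact: rel_gldim hM.
- exact: rel_domdim hM.
Qed.
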